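(* Let $d\ge 1$, let $c \colon \mathbb{R}^d\to\mathbb{C}$ be an $\mathbb{R}^d$-configuration and let $D = \{ \mathbf{d}_1, \ldots , \mathbf{d}_m \} \subseteq \mathbb{R}^d$ be a non-empty finite set with $m=|D|$. If $c$ has low complexity with respect to $D$, that is, if $P_c(D) \leq m$, then $c$ has a periodizer of the form $$a_1 X^{-\mathbf{d}_1} + \ldots + a_m X^{-\mathbf{d}_m}$$ for some non-zero $(a_1,\ldots,a_m) \in \mathbb{C}^m$.
   Context: An $\mathbb{R}^d$-configuration is a function $c\colon\mathbb{R}^d\to\mathbb{C}$ taking only finitely many values. The translation of $c$ by $\mathbf{t}\in\mathbb{R}^d$ is $\tau^{\mathbf{t}}(c)(\mathbf{u})=c(\mathbf{u}-\mathbf{t})$. The pattern complexity of $c$ with respect to a non-empty finite set $D\subseteq\mathbb{R}^d$ is $P_c(D)=|\{\tau^{\mathbf{t}}(c)|_D \mid \mathbf{t}\in\mathbb{R}^d\}|$. An $\mathbb{R}^d$-polynomial is a finitely supported function $f\colon\mathbb{R}^d\to\mathbb{C}$, written $f=\sum_{\mathbf{u}\in\mathrm{supp}(f)} f_{\mathbf{u}}X^{\mathbf{u}}$. The product of $f$ and $c$ is $(fc)(\mathbf{u})=\sum_{\mathbf{v}\in\mathrm{supp}(f)} f(\mathbf{v})\,c(\mathbf{u}-\mathbf{v})$. A function $g\colon\mathbb{R}^d\to\mathbb{C}$ is strongly periodic if there are $d$ vectors $\mathbf{t}$, linearly independent over $\mathbb{R}$, with $\tau^{\mathbf{t}}(g)=g$.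 $f$ is a periodizer of $c$ if $fc$ is strongly periodic. *)

(* Defs.v *)
From mathcomp Require Import all_boot all_order all_algebra finmap.
From mathcomp Require Import boolp classical_sets functions cardinality reals.
From mathcomp Require Import complex monalg.

Set Implicit Arguments.
Unset Strict Implicit.
Unset Printing Implicit Defensive.

Import GRing.Theory.

Local Open Scope ring_scope.
Local Open Scope classical_set_scope.

Definition configuration (R : realType) (d : nat) (c : 'rV[R]_d -> R[i]) : Prop :=
  finite_set (range c).

Definition translation (R : realType) (d : nat) (t : 'rV[R]_d)
    (c : 'rV[R]_d -> R[i]) : 'rV[R]_d -> R[i] :=
  fun u => c (u - t).

Definition pattern (R : realType) (d : nat) (c : 'rV[R]_d -> R[i])
    (D : {fset 'rV[R]_d}) : {ffun D -> R[i]} :=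
  [ffun u : D => c (val u)].

Definition patterns (R : realType) (d : nat) (c : 'rV[R]_d -> R[i])
    (D : {fset 'rV[R]_d}) : set {ffun D -> R[i]} :=
  [set pattern (translation t c) D | t in [set: 'rV[R]_d]].

Arguments patterns {R d} c D.

(* [fset_set A] is a junk value when [A] is infinite; by [finite_patterns]
   this never happens when [c] is a configuration. *)
Definition pattern_complexity (R : realType) (d : nat) (c : 'rV[R]_d -> R[i])
    (D : {fset 'rV[R]_d}) : nat :=
  #|` fset_set (patterns c D)|.

Lemma finite_patterns (R : realType) (d : nat) (c : 'rV[R]_d -> R[i])
    (D : {fset 'rV[R]_d}) : configuration c -> finite_set (patterns c D).
Proof.
move=> cfin; pose V := fset_set (range c).
have cV x : c x \in V by rewrite in_fset_set// inE; exists x.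
pose g (h : {ffun D -> V}) : {ffun D -> R[i]} := [ffun u => val (h u)].
apply: (@sub_finite_set _ _ (g @` setT)); last exact/finite_image/finite_finset.
move=> _ [t _ <-].
exists [ffun u : D => [` cV (val u - t)]%fset] => //.
by apply/ffunP => u; rewrite !ffunE.
Qed.

(* An R^d-polynomial is an element of [{malg R[i]['rV[R]_d]}]: a finitely
   supported function f from R^d to the complex numbers, with f_v = [f@_v] and
   a X^v = [<< a *g v >>]. *)
Definition polymul (R : realType) (d : nat) (f : {malg R[i]['rV[R]_d]})
    (c : 'rV[R]_d -> R[i]) : 'rV[R]_d -> R[i] :=
  fun u => \sum_(v <- msupp f) f@_v * c (u - v).

Definition strongly_periodic (R : realType) (d : nat)
    (g : 'rV[R]_d -> R[i]) : Prop :=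
  exists T : 'M[R]_d,
    row_free T /\ forall k : 'I_d, translation (row k T) g = g.

Definition periodizer (R : realType) (d : nat) (f : {malg R[i]['rV[R]_d]})
    (c : 'rV[R]_d -> R[i]) : Prop :=
  strongly_periodic (polymul f c).

(* Main.v *)
(* Writing p_t in C^m for the pattern of tau^t c on D, the value at u of
   (sum_k a_k X^(-d_k)) c is the pairing of a with p_(-u).  If the patterns do
   not span C^m, some non-zero a annihilates all of them and the product is 0.
   Otherwise there are exactly m of them and they form a basis, so some a pairs
   to 1 with each, and the product is the constant 1. *)

Require Import Defs.
From mathcomp Require Import all_boot all_order all_algebra finmap.
From mathcomp Require Import boolp classical_sets functions cardinality reals.
From mathcomp Require Import complex monalg.

Local Open Scope ring_scope.
Import GRing.Theory.

(** The [v k] may coincide and coefficients may cancel, so the sum over the support is first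
    enlarged to the image [S] of [v], where the added terms vanish; after exchanging the sums, each
    monomial contributes only at its own exponent. *)
Lemma polymul_sum_monomials (R : realType) (d m : nat) (a : 'I_m -> R[i])
    (v : 'I_m -> 'rV[R]_d) (c : 'rV[R]_d -> R[i]) (u : 'rV[R]_d) :
  polymul (\sum_(k < m) << a k *g v k >>) c u = \sum_(k < m) a k * c (u - v k).
Proof.
rewrite /polymul; pose S := [fset v k | k : 'I_m]%fset.
set f := \sum_(k < m) _.
have sub : (msupp f `<=` S)%fset.
  apply/fsubsetP => w; apply: contraTT => wS; rewrite -mcoeff_eq0 /f raddf_sum.
  rewrite big1 // => k _; rewrite /= mcoeffU; case: eqP => [e|//].
  by case/negP: wS; rewrite -e; apply/imfsetP; exists k.
rewrite (big_fset_incl _ sub) => [|w _ wf]; last by rewrite mcoeff_outdom ?mul0r.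
under eq_bigr do rewrite raddf_sum mulr_suml.
rewrite exchange_big /=; apply: eq_bigr => k _.
have vS : v k \in S by apply/imfsetP; exists k.
rewrite (big_fsetD1 _ vS) /= mcoeffUU big1_fset ?addr0 // => w.
by rewrite in_fsetD1 mcoeffU eq_sym => /andP[/negbTE -> _]; rewrite mulr0n mul0r.
Qed.

Lemma const_strongly_periodic (R : realType) (d : nat) (b : R[i]) :
  strongly_periodic (fun _ : 'rV[R]_d => b).
Proof. by exists 1%:M; split => [|k //]; rewrite row_free_unit unitmx1. Qed.

(** The columns of [A] will be the patterns: they fail to span exactly when the rows are dependent,
    which is the case [b = 0]; otherwise [A] is square and invertible, and [b = 1]. *)
Lemma tall_matrix_const_row_combination (F : fieldType) (m n : nat)
    (A : 'M[F]_(m, n)) :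
  (0 < m)%N -> (n <= m)%N ->
  exists (a : 'rV[F]_m) (b : F), a != 0 /\ a *m A = const_mx b.
Proof.
move=> m0 nm; have [Afree|] := boolP (row_free A); last first.
  rewrite -kermx_eq0 => /rowV0Pn[a /sub_kermxP aA a0].
  by exists a, 0; split; rewrite // aA; apply/matrixP => i j; rewrite !mxE.
have mn : (m <= n)%N by rewrite -(eqP Afree) rank_leq_col.
have {nm mn} e : m = n by apply/eqP; rewrite eqn_leq mn nm.
move: A Afree; rewrite -e => A; rewrite row_free_unit => Au.
exists (const_mx 1 *m invmx A), 1; rewrite mulmxKV //; split=> //.
(* A zero [a] would make the all-ones row zero; [m0] supplies an entry where this fails. *)
apply/eqP => /(congr1 (mulmx^~ A)); rewrite mulmxKV // mul0mx.
move/matrixP/(_ 0 (Ordinal m0)); rewrite !mxE; exact/eqP/oner_neq0.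
Qed.

Theorem lemma6p1 (R : realType) (d : nat) (hd : (1 <= d)%N)
    (c : 'rV[R]_d -> R[i]) (hc : configuration c)
    (m : nat) (dv : 'I_m -> 'rV[R]_d) (D : {fset 'rV[R]_d})
    (hDv : D = [fset dv k | k : 'I_m]%fset) (hD0 : D != fset0)
    (hm : m = #|` D|)
    (hlow : (pattern_complexity c D <= m)%N) :
  exists a : 'rV[R[i]]_m,
    a != 0 /\ periodizer (\sum_(k < m) << a 0 k *g - dv k >>) c.
Proof.
have dvD k : dv k \in D by rewrite hDv; apply/imfsetP; exists k.
have m0 : (0 < m)%N by rewrite hm cardfs_gt0.
pose P := fset_set (patterns c D).
have PP t : pattern (translation t c) D \in P.
  by rewrite in_fset_set ?inE; [exists t | exact: finite_patterns].
(* Rows stand for the points [dv k], columns for the distinct patterns, so [hlow] bounds the number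
   of columns by [m]. *)
pose A := \matrix_(k < m, j < #|{: P}|) val (enum_val j) [` dvD k]%fset.
have [|a [b [a0 aA]]] := tall_matrix_const_row_combination _ m _ A m0.
  by rewrite -cardfE.
exists a; split=> //; rewrite /periodizer.
suff -> : polymul (\sum_(k < m) << a 0 k *g - dv k >>) c = fun=> b.
  exact: const_strongly_periodic.
apply: funext => u; rewrite polymul_sum_monomials.
(* The column of the pattern of the translate by [- u] has entries [c (dv k + u)], the values needed
   at [u - (- dv k)]. *)
have /matrixP/(_ 0 (enum_rank [` PP (- u)]%fset)) := aA.
rewrite !mxE => <-; apply: eq_bigr => k _.
by rewrite mxE enum_rankK /= ffunE /translation /= !opprK addrC.
Qed.
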